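(* Let $A=\{P=0\}\subset\mathbb{C}^2$ be an irreducible algebraic curve of degree $d\ge2$ with distinct nonzero asymptotic directions $\lambda_1,\dots,\lambda_d$ (as in the context), and let $K\subset A$ be compact and nonpolar. Suppose the directions are labelled so that $$T(K,\lambda_1)\ge T(K,\lambda_2)\ge\cdots\ge T(K,\lambda_d).$$ Then for each $k\in\{1,\dots,d\}$ the limit defining $T(K,\mathcal{Z}(k-1))$ exists and $T(K,\mathcal{Z}(k-1))=T(K,\lambda_k)$.
   Context: **Curve.** $A=\{z\in\mathbb{C}^2:P(z)=0\}$ with $P$ an irreducible polynomial of degree $d$ whose leading homogeneous part is $\hat P(z)=C\prod_{k=1}^d(z_2-\lambda_kz_1)$, where $C\ne0$ and the $\lambda_k$ are distinct and nonzero (so $A$ has $d$ linear asymptotes, none parallel to another or to a coordinate axis). $K\subset A$ is nonpolar if $K\cap A^0$ is not a polar subset of the complex curve $A^0$ of regular points of $A$. **Degrees.** $\mathbb{C}[A]=\mathbb{C}[z_1,z_2]/\langle P\rangle$; the degree of an element is the minimal degree of a representing polynomial. **Chebyshev constants.** For a class $\mathcal{N}\subset\mathbb{C}[A]$ whose set of degrees $\deg(\mathcal{N})$ is unbounded and for $n\in\deg(\mathcal{N})$, put $T_n(K,\mathcal{N})=\inf\{\|p\|_K:p\in\mathcal{N},\ \deg p=n\}^{1/n}$, where $\|p\|_K=\max_K|p|$. Put $T(K,\mathcal{N})=\lim_{n\to\infty,\ n\in\deg(\mathcal{N})}T_n(K,\mathcal{N})$ when the limit exists. **Directional Chebyshev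 constants.** Let $\mathbf{v}_k=\prod_{j\neq k}\frac{z_2-\lambda_jz_1}{\lambda_k-\lambda_j}$, of degree $d-1$. Let $\mathcal{M}(\mathbf{v}_k)$ be the set of all elements of $\mathbb{C}[A]$ of the form $\mathbf{v}_k^n+(\text{terms of degree}<n(d-1))$, $n\in\mathbb{N}$. Then $T(K,\lambda_k):=T(K,\mathcal{M}(\mathbf{v}_k))$; this limit always exists. **Monomial classes.** Let $\mathcal{S}$ be the monomial basis of $\mathbb{C}[A]$ consisting of all monomials of degree $\le d-2$ together with $z_1^n,z_1^{n-1}z_2,\dots,z_1^{n-d+1}z_2^{d-1}$ for each degree $n\ge d-1$. It is ordered by increasing degree and, within a degree, by increasing power of $z_2$. For $k\in\{0,\dots,d-1\}$, $\mathcal{Z}(k)$ is the set of elements of $\mathbb{C}[A]$ of the form $z_2^kz_1^n$ plus a linear combination of elements of $\mathcal{S}$ strictly preceding $z_2^kz_1^n$, with $n\ge0$ an integer. *)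

(* Defs.v *)
From HB Require Import structures.
(* mpoly must be imported before mathcomp-analysis (notation clash). *)
From mathcomp Require Import all_boot all_order all_algebra ring_quotient.
From mathcomp Require Import complex mpoly.
From mathcomp Require Import all_classical all_reals all_analysis.

Set Implicit Arguments.
Unset Strict Implicit.
Unset Printing Implicit Defensive.

Import Order.TTheory GRing.Theory Num.Theory.
Import numFieldNormedType.Exports.

Local Open Scope classical_set_scope.
Local Open Scope ring_scope.
Local Open Scope complex_scope.
Local Open Scope quotient_scope.

(* R[i]^o is R[i] with the topology of its modulus; it is a normed module over
   the field R[i], so that [differentiable] on it means C-differentiable. *)
Notation Cplx R := (R[i]^o)%type.
Notation C2 R := (Cplx R * Cplx R)%type.

Section Polynomials.
Variable R : realType.
Implicit Types P p : {mpoly R[i][2]}.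

Definition z1 : {mpoly R[i][2]} := 'X_ord0.
Definition z2 : {mpoly R[i][2]} := 'X_ord_max.

Definition coords (z : C2 R) : 'I_2 -> R[i] :=
  fun i => if i == ord0 then z.1 else z.2.

Definition eval_at p (z : C2 R) : R[i] := p.@[coords z].

Definition irreducible_mpoly P : Prop :=
  [/\ P != 0, P \isn't a GRing.unit &
      forall f g : {mpoly R[i][2]}, P = f * g ->
        f \is a GRing.unit \/ g \is a GRing.unit].

(* msize is the total degree plus one. *)
Definition has_degree P (d : nat) : Prop := msize P = d.+1.

Definition hom_part P (d : nat) : {mpoly R[i][2]} :=
  pihomog [measure of mdeg] d P.

Definition curve P : set (C2 R) := [set z | eval_at P z = 0].

(* For irreducible P the regular points of the analytic set P = 0 are those
   where the gradient of P does not vanish. *)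
Definition regular_points P : set (C2 R) :=
  [set z | curve P z /\
           (eval_at P^`M(ord0) z != 0 \/ eval_at P^`M(ord_max) z != 0)].

End Polynomials.

Section Polar.
Variable R : realType.

Definition circle_pt (a : R[i]) (r t : R) : Cplx R :=
  a + r%:C * (cos t +i* sin t).

(* Convention: the constant -oo is subharmonic. The integral below is that of
   a function bounded above, hence meaningful, possibly equal to -oo. *)
Definition subharmonic (U : set (Cplx R)) (u : Cplx R -> \bar R) : Prop :=
  [/\ forall z, U z -> (u z < +oo)%E,
      forall z, U z -> forall b : R, (u z < b%:E)%E ->
        \forall w \near z, (u w < b%:E)%E &
      forall (a : Cplx R) (r : R), 0 < r ->
        (forall w : Cplx R, Normc.normc (w - a) <= r -> U w) ->
        (u a <= ((2 * pi)^-1)%:E *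
                \int[lebesgue_measure]_(t in `[0%R, (2 * pi)%R])
                  u (circle_pt a r t))%E].

(* phi : U -> A^0 is the inverse of a local holomorphic coordinate on A^0. *)
Definition local_parametrization (P : {mpoly R[i][2]}) (U : set (Cplx R))
    (phi : Cplx R -> C2 R) : Prop :=
  [/\ open U, connected U,
      forall z, U z -> differentiable phi z,
      forall z w, U z -> U w -> phi z = phi w -> z = w &
      exists2 V : set (C2 R), open V & phi @` U = regular_points P `&` V].

(* E is polar in the Riemann surface A^0: near every point of A^0 it lies in
   the -oo set of a subharmonic function that is not identically -oo. *)
Definition polar (P : {mpoly R[i][2]}) (E : set (C2 R)) : Prop :=
  forall a, regular_points P a ->
    exists U phi u,
      [/\ local_parametrization P U phi, (phi @` U) a, subharmonic U u,
          exists2 z, U z & u z != -oo%E &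
          forall z, U z -> E (phi z) -> u z = -oo%E].

Definition nonpolar (P : {mpoly R[i][2]}) (K : set (C2 R)) : Prop :=
  ~ polar P (K `&` regular_points P).

End Polar.

Section CoordinateRing.
Variables (R : realType) (P : {mpoly R[i][2]}) (irrP : irreducible_mpoly P).

Definition curve_ideal of irreducible_mpoly P : {mpoly R[i][2]} -> bool :=
  fun q => `[< exists r, q = r * P >].

Lemma curve_ideal_closed : idealr_closed (curve_ideal irrP).
Proof.
have [_ nuP _] := irrP; split.
- by apply/asboolP; exists 0; rewrite mul0r.
- apply/negP => /asboolP[r rP]; move: nuP; apply/negP; rewrite negbK.
  by apply/unitrPr; exists r; rewrite mulrC -rP.
- move=> a u v /asboolP[r ->] /asboolP[s ->]; apply/asboolP.
  by exists (a * r + s); rewrite mulrDl mulrA.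
Qed.

HB.instance Definition _ :=
  isIdealr.Build {mpoly R[i][2]} (curve_ideal irrP) curve_ideal_closed.

Definition coord_ring := {ideal_quot (Idealr.clone _ (curve_ideal irrP) _)}.
HB.instance Definition _ := GRing.ComNzRing.on coord_ring.
HB.instance Definition _ := Quotient.on coord_ring.

Definition cls (p : {mpoly R[i][2]}) : coord_ring := \pi p.

(* The value does not depend on the representative when z is on the curve. *)
Definition value (f : coord_ring) (z : C2 R) : R[i] := eval_at (repr f) z.

Lemma rep_degree_ex (f : coord_ring) :
  exists n, `[< exists2 p, cls p = f & (msize p).-1 = n >].
Proof.
exists (msize (repr f)).-1; apply/asboolP; exists (repr f) => //.
by rewrite /cls reprK.
Qed.

(* Convention: degree 0 = 0. *)
Definition degree (f : coord_ring) : nat := ex_minn (rep_degree_ex f).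

(* f has only terms of degree < m; in particular f = 0 if m = 0. *)
Definition degree_lt (m : nat) (f : coord_ring) : Prop :=
  exists2 p, cls p = f & (msize p <= m)%N.

Definition sup_norm (K : set (C2 R)) (f : coord_ring) : R :=
  sup [set Normc.normc (value f z) | z in K].

Definition degrees (N : set coord_ring) : set nat := degree @` N.

Definition cheb_const_n (K : set (C2 R)) (N : set coord_ring) (n : nat) : R :=
  inf [set sup_norm K f | f in [set f | N f /\ degree f = n]]
    `^ (n%:R)^-1.

Definition unbounded_degrees (N : set coord_ring) : Prop :=
  forall m : nat, exists2 n, (m <= n)%N & degrees N n.

Definition cheb_const_exists (K : set (C2 R)) (N : set coord_ring) : Prop :=
  unbounded_degrees N /\
  cvg (cheb_const_n K N n @[n --> within (degrees N) \oo]).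

Definition cheb_const (K : set (C2 R)) (N : set coord_ring) : R :=
  lim (cheb_const_n K N n @[n --> within (degrees N) \oo]).

Definition dir_poly (d : nat) (lambda : 'I_d -> R[i]) (k : 'I_d) :
    {mpoly R[i][2]} :=
  \prod_(j < d | j != k)
    ((lambda k - lambda j)^-1 *: (z2 R - lambda j *: z1 R)).

Definition dir_class (d : nat) (lambda : 'I_d -> R[i]) (k : 'I_d) :
    set coord_ring :=
  [set f | exists (n : nat) (g : coord_ring),
     degree_lt (n * (d - 1)) g /\ f = cls (dir_poly lambda k) ^+ n + g].

(* The monomial z1^a z2^b is encoded by its exponent m, with m ord0 = a and
   m ord_max = b. *)
Definition in_basis (d : nat) (m : 'X_{1..2}) : Prop :=
  (mdeg m <= d - 2)%N \/ (d - 1 <= mdeg m)%N /\ (m ord_max <= d - 1)%N.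

Definition precedes (m m' : 'X_{1..2}) : Prop :=
  (mdeg m < mdeg m')%N \/ mdeg m = mdeg m' /\ (m ord_max < m' ord_max)%N.

Definition expo (a b : nat) : 'X_{1..2} :=
  (U_(ord0) *+ a + U_(ord_max) *+ b)%MM.

Definition monomial_class (d k : nat) : set coord_ring :=
  [set f | exists (n : nat) (q : {mpoly R[i][2]}),
     (forall m, m \in msupp q -> in_basis d m /\ precedes m (expo n k)) /\
     f = cls ('X_[expo n k] + q)].

End CoordinateRing.

Arguments cls {R P} irrP p.
Arguments dir_class {R P} irrP {d} lambda k.
Arguments monomial_class {R P} irrP d k.

(* Main.v *)
Require Import Defs.
From HB Require Import structures.
From mathcomp Require Import all_boot all_order all_algebra ring_quotient.
From mathcomp Require Import complex mpoly zify.
From mathcomp Require Import all_classical all_reals all_analysis.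

Set Implicit Arguments.
Unset Strict Implicit.
Unset Printing Implicit Defensive.

Import Order.TTheory GRing.Theory Num.Theory.
Import numFieldNormedType.Exports.

Local Open Scope classical_set_scope.
Local Open Scope ring_scope.
Local Open Scope complex_scope.

(* Dehomogenizing the part of degree N of a representative (z1 = 1, z2 = X) gives
   a polynomial whose values at the lambda_j depend only on the class in C[A];
   these values are multiplicative, and f is an element of Z(k-1) of degree N iff
   they are those of a monic polynomial q of degree k - 1, while f is in
   M(v_j) iff they are those of the indicator of lambda_j.
   Upper bound: take q vanishing at lambda_1, ..., lambda_(k-1) and combine nearly
   optimal elements of the classes of v_k, ..., v_d, whose constants are at most
   T(K, lambda_k).  Lower bound: a monic q of degree k - 1 cannot be small at all of
   lambda_1, ..., lambda_k, and f * v_j isolates its value at lambda_j.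
   The limits T(K, lambda_j) exist by Fekete's lemma. *)

(** * Leading forms of bivariate polynomials *)

Section Homogenization.
Variable F : fieldType.
Implicit Types (p q : {mpoly F[2]}) (m : 'X_{1..2}) (a : {poly F}).

(* z1 and z2 are sent to X and tX, so that the coefficient of X^N is the
   homogeneous part of degree N evaluated at (1, t). *)
Definition affine_vars (i : 'I_2) : {poly {poly F}} :=
  if i == ord0 then 'X else 'X%:P * 'X.

Local Notation dehomog := (mmap (polyC \o polyC) affine_vars).

Definition topform (N : nat) p : {poly F} := (dehomog p)`_N.

Lemma mdeg2 m : mdeg m = (m ord0 + m ord_max)%N.
Proof. by rewrite mdegE big_ord_recl big_ord1; congr (_ + m _)%N; exact/val_inj. Qed.

Lemma mnm2P m m' : mdeg m = mdeg m' -> m ord_max = m' ord_max -> m = m'.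
Proof.
rewrite !mdeg2 => e1 e2; apply/mnmP => i; case: (unliftP ord0 i) => [j ->|->].
  by rewrite ord1 (_ : lift _ _ = ord_max) //; exact/val_inj.
by move: e1; rewrite e2 => /addIn.
Qed.

Lemma dehomogX m : dehomog 'X_[m] = ('X^(m ord_max))%:P * 'X^(mdeg m).
Proof.
rewrite mmapX /mmap1 big_ord_recl big_ord1 /affine_vars /=.
rewrite (_ : lift _ _ = ord_max); last exact/val_inj.
by rewrite exprMn -rmorphXn mulrCA -exprD mdeg2.
Qed.

Lemma dehomogZ c p : dehomog (c *: p) = c%:P%:P * dehomog p.
Proof. by rewrite mmapZ. Qed.

Lemma topformD N p q : topform N (p + q) = topform N p + topform N q.
Proof. by rewrite /topform rmorphD coefD. Qed.

Lemma topformB N p q : topform N (p - q) = topform N p - topform N q.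
Proof. by rewrite /topform rmorphB coefB. Qed.

Lemma topformZ N c p : topform N (c *: p) = c *: topform N p.
Proof. by rewrite /topform dehomogZ coefCM mul_polyC. Qed.

Lemma topform_sum N (I : Type) (r : seq I) (Q : pred I) (f : I -> {mpoly F[2]}) :
  topform N (\sum_(i <- r | Q i) f i) = \sum_(i <- r | Q i) topform N (f i).
Proof. by rewrite /topform rmorph_sum coef_sum. Qed.

Lemma topformX N m :
  topform N 'X_[m] = if mdeg m == N then 'X^(m ord_max) else 0.
Proof.
rewrite /topform dehomogX coefCM coefXn eq_sym.
by case: eqP; rewrite ?mulr1 ?mulr0.
Qed.

Lemma topformE N p :
  topform N p = \sum_(m <- msupp p | mdeg m == N) p@_m *: 'X^(m ord_max).
Proof.
rewrite {1}[p]mpolyE topform_sum [RHS]big_mkcond /=; apply: eq_bigr => m _.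
by rewrite topformZ topformX; case: ifP; rewrite ?scaler0.
Qed.

(** In two variables a monomial is determined by its total degree and its exponent of z2, so the
    polynomials [topform N p] together keep every coefficient of [p]. *)
Lemma coef_topform m p : (topform (mdeg m) p)`_(m ord_max) = p@_m.
Proof.
rewrite topformE coef_sum big_mkcond /=.
have [mp|mp] := boolP (m \in msupp p); last first.
  rewrite (memN_msupp_eq0 mp) big1_seq // => m' /andP[_ m'p].
  case: ifP => // /eqP e; rewrite coefZ coefXn; case: eqP; rewrite ?mulr0 // => e'.
  by case/negP: mp; rewrite (mnm2P (esym e) e').
rewrite (bigD1_seq m) ?msupp_uniq //= eqxx coefZ coefXn eqxx mulr1.
rewrite big1 ?addr0 // => m' ne; case: ifP => // /eqP e; rewrite coefZ coefXn.
by case: eqP; rewrite ?mulr0 // => e'; rewrite (mnm2P (esym e) e') eqxx in ne.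
Qed.

Lemma size_dehomog p : (size (dehomog p) <= msize p)%N.
Proof.
apply/leq_sizeP => N hN; rewrite -/(topform N p) topformE big1_seq // => m.
by case/andP => /eqP e /msize_mdeg_lt; rewrite e ltnNge hN.
Qed.

Lemma msize_leP p n : reflect (forall N, (n <= N)%N -> topform N p = 0) (msize p <= n)%N.
Proof.
apply: (iffP idP) => [le_pn N le_nN|p0].
  by apply: nth_default; exact: leq_trans (size_dehomog p) (leq_trans le_pn le_nN).
rewrite msizeE; apply/bigmax_leqP_seq => m mp _; rewrite ltnNge; apply/negP => /p0 e.
by move: mp; rewrite mcoeff_msupp -coef_topform e coef0 eqxx.
Qed.

Lemma size_topform N p : (size (topform N p) <= N.+1)%N.
Proof.
rewrite topformE; apply: (leq_trans (size_sum _ _ _)).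
apply/bigmax_leqP_seq => m _ /eqP <-; apply: leq_trans (size_scale_leq _ _) _.
by rewrite size_polyXn mdeg2 ltnS leq_addl.
Qed.

(** The coefficient of X^(N + M) is a convolution: an index above N kills the first factor, one
    below N the second, so a single term survives. *)
Lemma topformM N M p q : (msize p <= N.+1)%N -> (msize q <= M.+1)%N ->
  topform (N + M) (p * q) = topform N p * topform M q.
Proof.
move=> /msize_leP sp /msize_leP sq; rewrite /topform rmorphM coefM /=.
have lNM : (N < (N + M).+1)%N by rewrite ltnS leq_addr.
rewrite (bigD1 (Ordinal lNM)) //= addKn big1 ?addr0 // => -[i /= li].
rewrite -val_eqE /= => ne; have [lt|ge] := ltnP N i.
  by rewrite -/(topform i p) sp ?mul0r.
rewrite -/(topform (N + M - i) q) sq ?mulr0 // ltn_subRL ltn_add2r.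
by rewrite ltn_neqAle ne.
Qed.

Lemma msizeM_leS N M p q : (msize p <= N.+1)%N -> (msize q <= M.+1)%N ->
  (msize (p * q) <= (N + M).+1)%N.
Proof.
move=> sp sq; have [->|p0] := eqVneq p 0; first by rewrite mul0r mmeasure0.
have [->|q0] := eqVneq q 0; first by rewrite mulr0 mmeasure0.
by rewrite msizeM //; move: (leq_add sp sq); rewrite addnS addSn; case: (_ + _)%N.
Qed.

Lemma msizeD_leq n p q : (msize p <= n)%N -> (msize q <= n)%N ->
  (msize (p + q) <= n)%N.
Proof. by move=> sp sq; apply: leq_trans (mmeasureD_le _ _ _) _; rewrite geq_max sp. Qed.

(** The homogenization z1^N a(z2/z1), a section of [topform N] on polynomials of degree at most
    N. *)
Definition homog_of N a : {mpoly F[2]} :=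
  \sum_(i < N.+1) a`_i *: 'X_[expo (N - i) i].

Lemma expo_max i j : expo i j ord_max = j.
Proof. by rewrite /expo mnmDE !mulmnE !mnm1E /= mul1n. Qed.

Lemma mdeg_expo i j : mdeg (expo i j) = (i + j)%N.
Proof. by rewrite /expo mdegD !mdegMn !mdeg1 !mul1n. Qed.

Lemma msize_homog_of N a : (msize (homog_of N a) <= N.+1)%N.
Proof.
apply: leq_trans (mmeasure_sum _ _ _ _) _; apply/bigmax_leqP => i _.
apply: leq_trans (mmeasureZ_le _ _ _) _; rewrite msizeX mdeg_expo subnK //.
by rewrite -ltnS.
Qed.

Lemma topform_homog_of N a : (size a <= N.+1)%N -> topform N (homog_of N a) = a.
Proof.
move=> sa; rewrite topform_sum -[RHS](coefK) (poly_def).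
rewrite (big_ord_widen N.+1 (fun i => a`_i *: 'X^i)) // [RHS]big_mkcond /=.
apply: eq_bigr => -[i /= li] _; rewrite topformZ topformX mdeg_expo subnK ?eqxx //.
by rewrite expo_max; case: ltnP => // ge; rewrite nth_default // scale0r.
Qed.

Lemma topform_homog_of_ne N M a : M != N -> topform M (homog_of N a) = 0.
Proof.
move=> ne; rewrite topform_sum big1 // => -[i /= li] _.
by rewrite topformZ topformX mdeg_expo subnK // eq_sym (negbTE ne) scaler0.
Qed.

End Homogenization.

Section TopformProducts.
Variable F : fieldType.
Implicit Types (p q : {mpoly F[2]}).

Lemma topform_gt N n p : (msize p <= N)%N -> (N <= n)%N -> topform n p = 0.
Proof. by move=> /msize_leP h /h. Qed.

Lemma msize_topform0 N p : (msize p <= N.+1)%N -> topform N p = 0 -> (msize p <= N)%N.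
Proof.
move=> sp p0; apply/msize_leP => n; rewrite leq_eqVlt => /orP[/eqP <- //|].
exact: topform_gt.
Qed.

Lemma topform_prod (I : Type) (r : seq I) (Q : pred I) (f : I -> {mpoly F[2]}) :
  (forall i, Q i -> (msize (f i) <= 2)%N) ->
  let n := (\sum_(i <- r | Q i) 1)%N in
  (msize (\prod_(i <- r | Q i) f i) <= n.+1)%N /\
  topform n (\prod_(i <- r | Q i) f i) = \prod_(i <- r | Q i) topform 1 (f i).
Proof.
move=> sf; elim/big_rec3: _ => [|i a b e Qi [s2 s3]].
  by rewrite mmeasure1 /topform mmapC /= coefC eqxx.
by split; [apply: msizeM_leS; rewrite ?sf | rewrite topformM ?sf // s3].
Qed.

Lemma topform_exp N n p : (msize p <= N.+1)%N ->
  (msize (p ^+ n) <= (n * N).+1)%N /\ topform (n * N) (p ^+ n) = topform N p ^+ n.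
Proof.
move=> sp; elim: n => [|n [s IH]].
  by rewrite !expr0 mmeasure1 /topform mmapC /= coefC eqxx.
by rewrite !exprS mulSn topformM // IH; split=> //; exact: msizeM_leS.
Qed.

Lemma topform_pihomog N p : topform N (pihomog [measure of mdeg] N p) = topform N p.
Proof.
rewrite pihomogE topform_sum topformE; apply: eq_bigr => m /eqP e.
by rewrite topformZ topformX -e eqxx.
Qed.

Lemma homog_of_supp N (a : {poly F}) m : (size a <= N.+1)%N ->
  m \in msupp (homog_of N a) -> (m ord_max < size a)%N.
Proof.
move=> sa; rewrite mcoeff_msupp -coef_topform.
have [->|ne] := eqVneq (mdeg m) N; last by rewrite topform_homog_of_ne // coef0 eqxx.
by rewrite topform_homog_of //; case: ltnP => // ge; rewrite nth_default ?eqxx.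
Qed.

End TopformProducts.

Section LinearForms.
Variable R : realType.

Lemma msize_linear_form (l : R[i]) : (msize (z2 R - l *: z1 R) <= 2)%N.
Proof.
apply: msizeD_leq; rewrite ?mmeasureN; first by rewrite msizeX mdeg1.
by apply: leq_trans (mmeasureZ_le _ _ _) _; rewrite msizeX mdeg1.
Qed.

Lemma topform_linear_form (l : R[i]) : topform 1 (z2 R - l *: z1 R) = 'X - l%:P.
Proof.
by rewrite topformB topformZ !topformX !mdeg1 !eqxx !mnm1E /= expr1 expr0 alg_polyC.
Qed.

End LinearForms.

(** * Leading values on the coordinate ring *)

Section Curve.
Variables (R : realType) (P : {mpoly R[i][2]}) (irrP : irreducible_mpoly P).
Implicit Types (p q r : {mpoly R[i][2]}) (f g : coord_ring irrP).
Local Notation cl := (cls irrP).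

Lemma cls_eqP p q : cl p = cl q <-> exists r, p - q = r * P.
Proof.
split=> [/eqP e|h]; first by apply/asboolP; move: e; rewrite -Quotient.idealrBE.
by apply/eqP; rewrite -Quotient.idealrBE; apply/asboolP.
Qed.

Lemma clsD p q : cl (p + q) = cl p + cl q.
Proof. exact: rmorphD. Qed.
Lemma clsB p q : cl (p - q) = cl p - cl q.
Proof. exact: rmorphB. Qed.
Lemma clsM p q : cl (p * q) = cl p * cl q.
Proof. exact: rmorphM. Qed.
Lemma clsXn p n : cl (p ^+ n) = cl p ^+ n.
Proof. exact: rmorphXn. Qed.
Lemma cls_repr f : cl (repr f) = f.
Proof. exact: reprK. Qed.

Lemma degree_le n f p : cl p = f -> (msize p <= n.+1)%N -> (degree f <= n)%N.
Proof.
move=> e sp; rewrite /degree; case: ex_minnP => m _ min.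
apply: (@leq_trans (msize p).-1); first by apply: min; apply/asboolP; exists p.
by rewrite -ltnS; case: (msize p) sp.
Qed.

Lemma degree_rep f : exists2 p, cl p = f & (msize p <= (degree f).+1)%N.
Proof.
rewrite /degree; case: ex_minnP => m /asboolP[p e <-] _; exists p => //.
exact: leqSpred.
Qed.

Variables (d : nat) (c : R[i]) (lambda : 'I_d -> R[i]).
Hypotheses (degP : has_degree P d) (c_neq0 : c != 0).
Hypothesis lambda_inj : injective lambda.
Hypothesis leadP : hom_part P d = c *: \prod_(k < d) (z2 R - lambda k *: z1 R).

Definition dir_prod : {poly R[i]} := \prod_(k < d) ('X - (lambda k)%:P).

Lemma topform_curve : topform d P = c *: dir_prod.
Proof.
rewrite -topform_pihomog -/(hom_part P d) leadP topformZ.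
have [] := @topform_prod _ _ (index_enum 'I_d) predT _
  (fun k _ => msize_linear_form (lambda k)).
rewrite sum_nat_const card_ord muln1 => _ ->; congr (_ *: _).
by apply: eq_bigr => k _; rewrite topform_linear_form.
Qed.

Lemma size_dir_prod : size dir_prod = d.+1.
Proof. by rewrite size_prod_XsubC -[index_enum _]enumT size_enum_ord. Qed.

Lemma dir_prod_root k : dir_prod.[lambda k] = 0.
Proof. by rewrite /dir_prod (bigD1 k) //= hornerM hornerXsubC subrr mul0r. Qed.

(** The difference has degree less than d and d distinct roots. *)
Lemma poly_dir_eq (a b : {poly R[i]}) : (size a <= d)%N -> (size b <= d)%N ->
  (forall k, a.[lambda k] = b.[lambda k]) -> a = b.
Proof.
move=> sa sb e; apply/eqP; rewrite -subr_eq0; apply/eqP.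
apply: (@roots_geq_poly_eq0 _ _ [seq lambda k | k <- enum 'I_d]).
- by apply/allP => _ /mapP[k _ ->]; rewrite rootE !hornerE e subrr.
- by rewrite map_inj_uniq // enum_uniq.
- rewrite size_map size_enum_ord; apply: leq_trans (size_polyD _ _) _.
  by rewrite size_polyN geq_max sa.
Qed.

(* Elements of the coordinate ring are reduced by dividing the leading forms
   by the one of P, one degree at a time. *)
Lemma normal_form N p : (msize p <= N)%N ->
  exists q, [/\ cl q = cl p, (msize q <= N)%N &
    forall m, m \in msupp q -> (m ord_max < d)%N].
Proof.
elim: N p => [|N IH] p sp.
  exists p; split=> // m; move: sp; rewrite leqn0 mmeasure_msupp0 => /eqP -> //.
pose H := topform N p; pose Q := H %/ dir_prod; pose S := H %% dir_prod.
have pi0 : dir_prod != 0 by rewrite -size_poly_gt0 size_dir_prod.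
(* Subtracting this multiple of [P] leaves in degree N only the remainder [S], whose degree is less
   than d. *)
have [s [ss sQ]] : exists s, (msize (s * P) <= N.+1)%N /\
    topform N (s * P) = Q * dir_prod.
  have [le_dN|lt_Nd] := leqP d N; last first.
    (* Below degree d the quotient [Q] is 0. *)
    exists 0; rewrite mul0r mmeasure0 /Q divp_small ?mul0r ?(topform_gt _ (leqnn _)) ?mmeasure0 //.
    by rewrite size_dir_prod ltnS (leq_trans (size_topform _ _)).
  have sQ : (size Q <= (N - d).+1)%N.
    rewrite size_divp // size_dir_prod /= -subSn // leq_sub2r //.
    exact: size_topform.
  exists (c^-1 *: homog_of (N - d) Q).
  have s1 : (msize (c^-1 *: homog_of (N - d) Q) <= (N - d).+1)%N.
    exact: leq_trans (mmeasureZ_le _ _ _) (msize_homog_of _ _).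
  have sP : (msize P <= d.+1)%N by rewrite degP.
  rewrite -[N in (_ <= N.+1)%N](subnK le_dN) -[X in topform X](subnK le_dN).
  split; first exact: msizeM_leS.
  rewrite topformM // topformZ topform_homog_of // topform_curve.
  by rewrite -scalerAl -scalerAr scalerA mulVf // scale1r.
have sS : (size S <= N.+1)%N.
  by apply: leq_trans (leq_modp _ _) (size_topform _ _).
have sp' : (msize (p - s * P - homog_of N S) <= N)%N.
  apply: msize_topform0.
    by apply: msizeD_leq; first apply: msizeD_leq; rewrite ?mmeasureN // msize_homog_of.
  rewrite !topformB sQ topform_homog_of // -/H {1}(divp_eq H dir_prod).
  by rewrite -/Q -/S [_ + S]addrC addrK subrr.
have [q [e sq mq]] := IH _ sp'; exists (q + homog_of N S); split.
- rewrite clsD e -clsD subrK; apply/cls_eqP; exists (- s).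
  by rewrite addrAC subrr add0r mulNr.
- by apply: msizeD_leq; [exact: leq_trans sq _ | exact: msize_homog_of].
- move=> m /msuppD_le; rewrite mem_cat => /orP[/mq //|/homog_of_supp].
  move=> /(_ sS) /leq_trans; apply; rewrite -ltnS -size_dir_prod.
  by rewrite ltn_modp.
Qed.

(** N only bounds the degree: [w = 0] is allowed and means degree less than N ([lead0_degree_lt]).
    By [topform_cls] the values do not depend on the representative. *)
Definition lead (N : nat) f (w : 'I_d -> R[i]) : Prop :=
  exists p, [/\ cl p = f, (msize p <= N.+1)%N &
    forall k, (topform N p).[lambda k] = w k].

Lemma eq_lead N f w u : (forall k, w k = u k) -> lead N f w -> lead N f u.
Proof. by move=> e [p [cp sp tp]]; exists p; split=> // k; rewrite tp. Qed.

Lemma leadD N f g w u : lead N f w -> lead N g u ->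
  lead N (f + g) (fun k => w k + u k).
Proof.
move=> [p [<- sp tp]] [q [<- sq tq]]; exists (p + q); split.
- by rewrite clsD.
- exact: msizeD_leq.
- by move=> k; rewrite topformD hornerD (tp k) (tq k).
Qed.

Lemma leadB N f g w u : lead N f w -> lead N g u ->
  lead N (f - g) (fun k => w k - u k).
Proof.
move=> [p [<- sp tp]] [q [<- sq tq]]; exists (p - q); split.
- by rewrite clsB.
- by apply: msizeD_leq; rewrite ?mmeasureN.
- by move=> k; rewrite topformB hornerD hornerN (tp k) (tq k).
Qed.

Lemma leadZ N f w (a : R[i]) : lead N f w ->
  lead N (cl a%:MP * f) (fun k => a * w k).
Proof.
move=> [p [<- sp tp]]; exists (a *: p); split.
- by rewrite -mul_mpolyC clsM.
- exact: leq_trans (mmeasureZ_le _ _ _) sp.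
- by move=> k; rewrite topformZ hornerZ tp.
Qed.

Lemma leadM N M f g w u : lead N f w -> lead M g u ->
  lead (N + M) (f * g) (fun k => w k * u k).
Proof.
move=> [p [<- sp tp]] [q [<- sq tq]]; exists (p * q); split.
- by rewrite clsM.
- exact: msizeM_leS.
- by move=> k; rewrite topformM // hornerM tp tq.
Qed.

Lemma degree_lt_lead N f : degree_lt N f -> lead N f (fun=> 0).
Proof.
move=> [p cp sp]; exists p; split=> //; first exact: leqW.
by move=> k; rewrite (topform_gt sp) // horner0.
Qed.

Lemma lead_sum N (I : Type) (r : seq I) (Q : pred I) (f : I -> coord_ring irrP)
    (w : I -> 'I_d -> R[i]) :
  (forall i, Q i -> lead N (f i) (w i)) ->
  lead N (\sum_(i <- r | Q i) f i) (fun k => \sum_(i <- r | Q i) w i k).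
Proof.
move=> h; elim: r => [|i r IH].
  apply: (@eq_lead _ _ (fun=> 0)) => [k|]; first by rewrite big_nil.
  rewrite big_nil; apply: degree_lt_lead; exists 0; last by rewrite mmeasure0.
  exact: rmorph0.
apply: (@eq_lead _ _ (fun k => (if Q i then w i k else 0) + \sum_(i <- r | Q i) w i k)).
  by move=> k; rewrite big_cons; case: ifP; rewrite ?add0r.
rewrite big_cons; case: ifP => [Qi|_]; first exact: leadD (h _ Qi) IH.
by apply: eq_lead IH => k; rewrite add0r.
Qed.

(** The degree N part of such a multiple of [P] is a multiple of the leading form of [P], which
    vanishes in every direction. *)
Lemma topform_ideal N r k : (msize (r * P) <= N.+1)%N ->
  (topform N (r * P)).[lambda k] = 0.
Proof.
have P0 : P != 0 by have [] := irrP.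
have [->|r0] := eqVneq r 0.
  by rewrite mul0r (@topform_gt _ 0) ?mmeasure0 // horner0.
rewrite msizeM // degP addnS /= => sr.
have le_dN : (d <= N)%N.
  rewrite -ltnS; apply: leq_trans sr; rewrite -[X in (X < _)%N]add0n ltn_add2r.
  by rewrite lt0n mmeasure_poly_eq0.
have {}sr : (msize r <= (N - d).+1)%N by move: (msize r) sr => n; lia.
rewrite -[X in topform X](subnK le_dN) topformM ?degP //.
by rewrite topform_curve hornerM hornerZ dir_prod_root !mulr0.
Qed.

(** Two representatives differ by a multiple of [P]. This makes leading values well defined on the
    coordinate ring. *)
Lemma topform_cls N p q k : cl p = cl q -> (msize p <= N.+1)%N ->
  (msize q <= N.+1)%N -> (topform N p).[lambda k] = (topform N q).[lambda k].
Proof.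
move=> /cls_eqP[r e] sp sq; apply/eqP; rewrite -subr_eq0 -hornerN -hornerD.
rewrite -topformB e topform_ideal // -e.
by apply: msizeD_leq; rewrite ?mmeasureN.
Qed.

(** A representative of degree less than N would make all leading values 0. *)
Lemma lead_degree N f w k : lead N f w -> w k != 0 -> degree f = N.
Proof.
move=> [p [cp sp tp]] wk; apply/eqP; rewrite eqn_leq (degree_le cp sp) /=.
rewrite leqNgt; apply/negP => lt; have [q cq sq] := degree_rep f.
have sqN : (msize q <= N)%N by apply: leq_trans sq lt.
case/negP: wk; rewrite -tp (@topform_cls _ _ q) ?(topform_gt sqN) ?horner0 //.
- by rewrite cp cq.
- exact: leqW.
Qed.

(** In a reduced representative z2 has exponent less than d, so its degree N part is determined by
    its values at the d directions. *)
Lemma lead_normal_form N f w : lead N f w -> exists p,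
  [/\ cl p = f, (msize p <= N.+1)%N, (size (topform N p) <= d)%N,
      (forall m, m \in msupp p -> (m ord_max < d)%N) &
      forall k, (topform N p).[lambda k] = w k].
Proof.
move=> [p [<- sp tp]]; have [q [cq sq mq]] := normal_form sp.
have sN : (size (topform N q) <= d)%N.
  rewrite topformE; apply: (leq_trans (size_sum _ _ _)).
  apply/bigmax_leqP_seq => m mm _; apply: leq_trans (size_scale_leq _ _) _.
  by rewrite size_polyXn mq.
exists q; split; [exact: cq|exact: sq|exact: sN|exact: mq|].
by move=> k; rewrite -tp; apply: topform_cls.
Qed.

(** A reduced degree N part vanishing in all d directions is zero. Hence elements with equal leading
    values agree modulo lower degree. *)
Lemma lead0_degree_lt N f : lead N f (fun=> 0) -> degree_lt N f.
Proof.
move/lead_normal_form => [p [cp sp dp mp tp]]; exists p => //.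
apply: msize_topform0 => //; apply: poly_dir_eq; rewrite ?size_poly0 // => k.
by rewrite tp horner0.
Qed.

Lemma lead_X m : lead (mdeg m) (cl 'X_[m]) (fun k => lambda k ^+ m ord_max).
Proof.
exists 'X_[m]; split; rewrite ?msizeX // => k.
by rewrite topformX eqxx hornerXn.
Qed.

(** The leading form of v_k is the Lagrange basis polynomial of lambda_k at the nodes lambda_j. *)
Lemma lead_dir k : lead (d - 1) (cl (dir_poly lambda k)) (fun j => (j == k)%:R).
Proof.
have sz j : j != k ->
    (msize ((lambda k - lambda j)^-1 *: (z2 R - lambda j *: z1 R)) <= 2)%N.
  by move=> _; apply: leq_trans (mmeasureZ_le _ _ _) (msize_linear_form _).
have [] := topform_prod (index_enum 'I_d) sz.
have -> : (\sum_(j < d | j != k) 1 = d - 1)%N.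
  by rewrite sum1_card cardC1 card_ord subn1.
rewrite -/(dir_poly lambda k) => s t; exists (dir_poly lambda k); split=> // i.
rewrite t horner_prod; have [->|ne] := eqVneq i k.
  apply: big1 => j jk; rewrite topformZ topform_linear_form hornerZ hornerXsubC.
  by rewrite mulVf // subr_eq0; apply: contra jk => /eqP/lambda_inj ->.
rewrite (bigD1 i) //= topformZ topform_linear_form hornerZ hornerXsubC subrr.
by rewrite mulr0 mul0r.
Qed.

(** * The directional and monomial classes in terms of leading values *)

Hypothesis d_ge2 : (2 <= d)%N.

(** Indicator values are idempotent, so all positive powers of v_k share them, and elements with the
    same leading values differ by terms of lower degree. Degree 0 is excluded because v_k^0 = 1 has
    leading value 1 in every direction. *)
Lemma dir_classP k N f : (0 < N)%N ->
  (dir_class irrP lambda k f /\ degree f = N) <->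
  (d - 1 %| N)%N /\ lead N f (fun j => (j == k)%:R).
Proof.
move=> N0; have lv n : lead (n * (d - 1)) (cl (dir_poly lambda k) ^+ n)
    (fun j => (j == k)%:R ^+ n).
  have [p [<- sp tp]] := lead_dir k; have [s t] := topform_exp n sp.
  by exists (p ^+ n); split; rewrite ?clsXn // => j; rewrite t horner_exp tp.
split=> [[[n [g [gl ->]]] degf]|[/dvdnP[n eN] L]].
  have [n0|n0] := posnP n.
    (* For n = 0 the lower order part is 0, so the element is 1, of degree 0. *)
    exfalso; move: gl degf; rewrite n0 expr0 mul0n => -[p <-].
    rewrite leqn0 mmeasure_poly_eq0 => /eqP ->; rewrite /cls rmorph0 addr0 => dN.
    move: N0; rewrite -dN lt0n => /negP; apply; rewrite -leqn0.
    by apply: (@degree_le _ _ 1); rewrite ?msize1 //; exact: rmorph1.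
  have L : lead (n * (d - 1)) (cl (dir_poly lambda k) ^+ n + g)
      (fun j => (j == k)%:R).
    apply: eq_lead (leadD (lv n) (degree_lt_lead gl)) => j.
    by rewrite addr0; case: eqP; rewrite ?expr1n // expr0n gtn_eqF.
  have eN : N = (n * (d - 1))%N by rewrite -degf (lead_degree (k := k) L) ?eqxx ?oner_eq0.
  by rewrite eN dvdn_mull.
split; last by apply: (lead_degree (k := k) L); rewrite eqxx oner_eq0.
exists n, (f - cl (dir_poly lambda k) ^+ n); split; last by rewrite addrC subrK.
rewrite -eN; apply: lead0_degree_lt.
have n0 : (0 < n)%N by move: N0; rewrite eN muln_gt0 => /andP[].
have := lv n; rewrite -eN => /(leadB L); apply: eq_lead => j.
by case: eqP => _; rewrite ?expr1n ?expr0n ?(gtn_eqF n0) subrr.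
Qed.

(** Monomials preceding z2^k z1^n in the same degree have a smaller power of z2, so the degree n + k
    part is monic of degree k. Conversely, a reduced representative has degree N part exactly [q]
    and is supported on the basis. Indices start at 0. *)
Lemma monomial_classP (k : 'I_d) N f :
  (monomial_class irrP d k f /\ degree f = N) <->
  exists q : {poly R[i]}, [/\ q \is monic, size q = k.+1 &
    lead N f (fun j => q.[lambda j])].
Proof.
(* As k < d, [q] cannot vanish in all d directions, so the degree is exactly N. *)
have ne0 (q : {poly R[i]}) : q \is monic -> size q = k.+1 ->
    exists j, q.[lambda j] != 0.
  move=> mq sq; apply/not_existsP => h.
  have : q = 0.
    apply: poly_dir_eq; rewrite ?size_poly0 ?sq // => j; rewrite horner0.
    by apply/eqP; apply: contraT => /h.
  by move=> q0; move: sq; rewrite q0 size_poly0.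
split=> [[[n [q [mq ->]]] degf]|[q [mq sq L]]].
  pose e := expo n k; pose a := topform (n + k) ('X_[e] + q).
  have ae : a = 'X^k + topform (n + k) q.
    by rewrite /a topformD topformX mdeg_expo eqxx expo_max.
  have sq : (size (topform (n + k) q) < k.+1)%N.
    rewrite ltnS topformE; apply: (leq_trans (size_sum _ _ _)).
    apply/bigmax_leqP_seq => m mm /eqP dm; apply: leq_trans (size_scale_leq _ _) _.
    have [_] := mq _ mm; rewrite /precedes mdeg_expo dm ltnn expo_max size_polyXn.
    by case=> // -[].
  have sa : size a = k.+1 by rewrite ae size_polyDl size_polyXn.
  have ma : a \is monic.
    by rewrite monicE ae lead_coefDl ?size_polyXn // lead_coefXn.
  have L : lead (n + k) (cl ('X_[e] + q)) (fun j => a.[lambda j]).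
    exists ('X_[e] + q); split=> //; apply: msizeD_leq.
      by rewrite msizeX mdeg_expo.
    rewrite msizeE; apply/bigmax_leqP_seq => m mm _; have [_] := mq _ mm.
    by rewrite /precedes mdeg_expo ltnS => -[/ltnW //|[-> _]].
  have [j aj] := ne0 _ ma sa.
  by exists a; split=> //; rewrite -degf (lead_degree L aj).
have [j qj] := ne0 _ mq sq; split; last exact: lead_degree L qj.
have [p [cp sp dp mp tp]] := lead_normal_form L.
have tpq : topform N p = q by apply: poly_dir_eq; rewrite ?sq.
have le_kN : (k <= N)%N by rewrite -ltnS -sq -tpq size_topform.
exists (N - k)%N, (p - 'X_[expo (N - k) k]); split; last by rewrite addrC subrK.
have te : topform N ('X_[expo (N - k) k] : {mpoly R[i][2]}) = 'X^k.
  by rewrite topformX mdeg_expo subnK // eqxx expo_max.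
move=> m mm; have lt_md : (m ord_max < d)%N.
  move: mm => /msuppB_le; rewrite mem_cat => /orP[/mp //|].
  by rewrite msuppX mem_seq1 => /eqP ->; rewrite expo_max.
have le_m : (mdeg m <= N)%N.
  rewrite -ltnS; apply: leq_trans (msize_mdeg_lt mm) _.
  by apply: msizeD_leq => //; rewrite mmeasureN msizeX mdeg_expo subnK.
split.
  rewrite /in_basis; case: leqP => [_|lt]; [by left|right].
  by split; lia.
rewrite /precedes mdeg_expo subnK // expo_max; move: le_m.
rewrite leq_eqVlt => /orP[/eqP em|]; [right|by left]; split=> //.
(* The coefficient of a degree N monomial is one of [q - 'X^k], which has none at exponents k and
   above since [q] is monic of degree k. *)
rewrite ltnNge; apply/negP => ge; move: mm; rewrite mcoeff_msupp -coef_topform.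
rewrite em topformB tpq te coefB coefXn; case/negP; move: ge.
rewrite leq_eqVlt => /orP[/eqP <-|gt].
  by move: mq; rewrite monicE lead_coefE sq => /eqP ->; rewrite eqxx subrr.
by rewrite nth_default ?sq // gtn_eqF // subrr.
Qed.

(** Powers of z1 have leading value 1 in every direction, so multiplying v_k by them reaches every
    degree from d - 1 on, not just the multiples of d - 1. *)
Lemma lead_exists N k : (d - 1 <= N)%N -> exists f, lead N f (fun j => (j == k)%:R).
Proof.
move=> le; exists (cl (dir_poly lambda k) * cl 'X_[expo (N - (d - 1)) 0]).
have := leadM (lead_dir k) (lead_X (expo (N - (d - 1)) 0)).
rewrite mdeg_expo addn0 subnKC //; apply: eq_lead => j.
by rewrite expo_max expr0 mulr1.
Qed.

End Curve.

(** * Growth rates *)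

Section NthRoots.
Variable R : realType.
Implicit Types (A : set R) (x y : nat -> R) (a b L C : R).

Lemma has_lbound_ge0 A : (forall a, A a -> 0 <= a) -> has_lbound A.
Proof. by move=> A0; exists 0 => a /A0. Qed.

Lemma inf_ge0 A : (forall a, A a -> 0 <= a) -> 0 <= inf A.
Proof.
move=> A0; have [->|/set0P ne] := eqVneq A set0; first by rewrite inf0.
exact: lb_le_inf.
Qed.

(** Applied to one factor at a time, this bounds [t] by a product of two infima. *)
Lemma le_inf_mulr A b t : A !=set0 -> (forall a, A a -> 0 <= a) -> 0 <= b ->
  (forall a, A a -> t <= a * b) -> t <= inf A * b.
Proof.
move=> ne A0; rewrite le_eqVlt => /orP[/eqP <-|b0] h.
  by have [a Aa] := ne; rewrite mulr0; have := h a Aa; rewrite mulr0.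
by rewrite -ler_pdivrMr //; apply: lb_le_inf => // a Aa; rewrite ler_pdivrMr // h.
Qed.

Lemma powR_invK a (n : nat) : 0 <= a -> (0 < n)%N -> (a `^ n%:R^-1) ^+ n = a.
Proof.
move=> a0 n0; rewrite -powR_mulrn ?powR_ge0 // -powRrM mulVf ?powRr1 //.
by rewrite pnatr_eq0 -lt0n.
Qed.

Lemma powR_exprK a (n : nat) : 0 <= a -> (0 < n)%N -> (a ^+ n) `^ n%:R^-1 = a.
Proof.
move=> a0 n0; rewrite -powR_mulrn // -powRrM mulfV ?powRr1 //.
by rewrite pnatr_eq0 -lt0n.
Qed.

Lemma le_nth_root a b (n : nat) : 0 <= a -> a <= b -> a `^ n%:R^-1 <= b `^ n%:R^-1.
Proof.
move=> a0 ab; apply: (ge0_ler_powR (r := n%:R^-1)) => //.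
by rewrite nnegrE (le_trans a0).
Qed.

Lemma cvg_nth_root a : 0 < a -> a `^ n%:R^-1 @[n --> \oo] --> (1 : R).
Proof.
move=> a0; have -> : (fun n : nat => a `^ n%:R^-1) = (fun n => expR (n%:R^-1 * ln a)).
  by apply/funext => n; rewrite /powR gt_eqF.
rewrite -[X in _ --> X]expR0; apply: continuous_cvg; first exact: continuous_expR.
rewrite -[X in _ --> X](mul0r (ln a)); apply: cvgMl.
apply/gtr0_cvgV0; last exact: cvgr_idn.
by near=> n; rewrite ltr0n; near: n; exact: nbhs_infty_gt.
Unshelve. all: by end_near. Qed.

(** Fekete's lemma in multiplicative form, with L the infimum of the n-th roots over n >= n0. It
    gives bounds on [x n] rather than a limit, because these bounds are reused when elements are
    combined. *)
Lemma fekete x n0 : (0 < n0)%N -> (forall n, 0 <= x n) ->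
  (forall n m, (n0 <= n)%N -> (n0 <= m)%N -> x (n + m)%N <= x n * x m) ->
  exists L, [/\ 0 <= L, forall n, (n0 <= n)%N -> L ^+ n <= x n &
    forall b, L < b -> exists2 C, 0 < C &
      exists n1, forall n, (n1 <= n)%N -> x n <= C * b ^+ n].
Proof.
move=> n0_gt0 x0 xM; pose S := [set x n `^ n%:R^-1 | n in [set n | (n0 <= n)%N]].
have S0 a : S a -> 0 <= a by move=> [n _ <-]; exact: powR_ge0.
have L0 : 0 <= inf S by exact: inf_ge0.
exists (inf S); split=> // [n le_n|b lt_b].
  have n_gt0 : (0 < n)%N by exact: leq_trans le_n.
  rewrite -[leRHS](powR_invK (x0 n) n_gt0) ler_pXn2r ?nnegrE ?powR_ge0 //.
  by apply: ge_inf; [exact: has_lbound_ge0 | exists n].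
have b0 : 0 < b by exact: le_lt_trans lt_b.
have [|_ [m le_m <-] lt_m] := inf_lt _ lt_b; first by exists (x n0 `^ n0%:R^-1), n0 => /=.
have m_gt0 : (0 < m)%N by exact: leq_trans le_m.
have xm : x m <= b ^+ m.
  rewrite -[leLHS](powR_invK (x0 m) m_gt0) ler_pXn2r ?nnegrE ?powR_ge0 //; exact: ltW.
(* The block [m] is split off q times; keeping [r] at least [m] keeps submultiplicativity
   available. *)
have step q r : (m <= r)%N -> x (q * m + r)%N <= b ^+ (q * m) * x r.
  move=> le_mr; elim: q => [|q IH]; first by rewrite mul0n expr0 mul1r.
  rewrite mulSn -addnA exprD -mulrA; apply: le_trans (xM _ _ _ _) _ => //.
    by apply: leq_trans le_m _; apply: leq_trans le_mr _; rewrite leq_addl.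
  exact: ler_pM.
(* The sum bounds [x r / b ^+ r] for every possible remainder m <= r < 2m; the 1 makes the constant
   positive. *)
exists (1 + \sum_(r < m + m) x r / b ^+ r).
  by apply: ltr_pwDl => //; apply: sumr_ge0 => r _; rewrite divr_ge0 // exprn_ge0 // ltW.
exists m => n le_mn; have lt_r : ((n - m) %% m + m < m + m)%N.
  by rewrite ltn_add2r ltn_pmod.
have -> : n = ((n - m) %/ m * m + ((n - m) %% m + m))%N.
  by rewrite addnA -divn_eq subnK.
set r := (_ %% m + m)%N; apply: le_trans (step _ r _) _; first by rewrite leq_addl.
rewrite exprD mulrCA; apply: ler_wpM2l; first by rewrite exprn_ge0 // ltW.
rewrite -ler_pdivrMr ?exprn_gt0 // (bigD1 (Ordinal lt_r)) //= addrCA lerDl.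
by rewrite addr_ge0 ?ler01 // sumr_ge0 // => j _; rewrite divr_ge0 // exprn_ge0 // ltW.
Qed.

(** Constant factors disappear because C^(1/n) tends to 1. For L = 0 the lower estimate is just
    nonnegativity. *)
Lemma nth_root_cvg x L : (forall n, 0 <= x n) -> 0 <= L ->
  (forall b, L < b -> exists2 C, 0 < C &
     exists n1, forall n, (n1 <= n)%N -> x n <= C * b ^+ n) ->
  (0 < L -> exists2 C, 0 < C &
     exists n1, forall n, (n1 <= n)%N -> C * L ^+ n <= x n) ->
  x n `^ n%:R^-1 @[n --> \oo] --> L.
Proof.
move=> x0 L0 up low.
apply/cvgrPdist_lt => e e0.
have lt_b : L < L + e / 2 by rewrite ltrDl divr_gt0.
have b0 : 0 < L + e / 2 by exact: le_lt_trans lt_b.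
have [C C0 [n1 xC]] := up _ lt_b.
have Cb : C `^ n%:R^-1 * (L + e / 2) @[n --> \oo] --> L + e / 2.
  by rewrite -[X in _ --> X]mul1r; apply: cvgMl; exact: cvg_nth_root.
have lt_e : L + e / 2 < L + e by rewrite ltrD2l ltr_pdivrMr // ltr_pMr // ltr1n.
have up_near : \forall n \near \oo, x n `^ n%:R^-1 < L + e.
  near=> n; have n_gt0 : (0 < n)%N by near: n; exact: nbhs_infty_gt.
  apply: (@le_lt_trans _ _ (C `^ n%:R^-1 * (L + e / 2))).
    rewrite -(powR_exprK (ltW b0) n_gt0) -powRM ?exprn_ge0 ?(ltW b0) ?(ltW C0) //.
    by apply: le_nth_root => //; apply: xC; near: n; exact: nbhs_infty_ge.
  by near: n; exact: cvgr_lt Cb _ lt_e.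
have low_near : \forall n \near \oo, L - e < x n `^ n%:R^-1.
  move: L0; rewrite le_eqVlt => /orP[/eqP <-|L_gt0].
    by near=> n; rewrite sub0r; apply: lt_le_trans (powR_ge0 _ _); rewrite oppr_lt0.
  have [D D0 [n2 xD]] := low L_gt0.
  have DL : D `^ n%:R^-1 * L @[n --> \oo] --> L.
    by rewrite -[X in _ --> X]mul1r; apply: cvgMl; exact: cvg_nth_root.
  near=> n; have n_gt0 : (0 < n)%N by near: n; exact: nbhs_infty_gt.
  apply: (@lt_le_trans _ _ (D `^ n%:R^-1 * L)).
    by near: n; apply: cvgr_gt DL _ _; rewrite gtrDl oppr_lt0.
  rewrite -(powR_exprK (ltW L_gt0) n_gt0) -powRM ?exprn_ge0 ?(ltW L_gt0) ?(ltW D0) //.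
  apply: le_nth_root; first by rewrite mulr_ge0 ?exprn_ge0 ?ltW.
  by apply: xD; near: n; exact: nbhs_infty_ge.
near=> n; rewrite ltr_distl; apply/andP; split.
  by rewrite ltrBlDr; near: n.
by rewrite -ltrBlDr; near: n.
Unshelve. all: by end_near. Qed.

End NthRoots.

(** * Sup norms *)

Section CoordinateNorms.
Variable R : realType.
Implicit Types (K : set (C2 R)).

Lemma normc_ge0 (z : R[i]) : 0 <= Normc.normc z.
Proof. by case: z => a b; exact: sqrtr_ge0. Qed.

Lemma normcE2 (z : R[i]) : `|z| = (Normc.normc z)%:C.
Proof. by []. Qed.

Lemma normcD_le (x y : R[i]) :
  Normc.normc (x + y) <= Normc.normc x + Normc.normc y.
Proof. by have := ler_normD x y; rewrite !normcE2 -rmorphD lecR. Qed.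

Lemma normcB_sym (x y : R[i]) : Normc.normc (x - y) = Normc.normc (y - x).
Proof. by have := distrC x y; rewrite !normcE2 => -[]. Qed.

Lemma continuous_normc (f : C2 R -> R[i]) :
  (forall z, f w @[w --> z] --> (f z : Cplx R)) ->
  continuous (fun z => Normc.normc (f z)).
Proof.
move=> cf z; apply/cvgrPdist_lt => e e0.
have eC : 0 < e%:C by rewrite ltcR.
have /(cvgrPdist_lt (V := Cplx R)) h := cf z.
have := h _ eC; apply: filterS => w.
rewrite normcE2 ltcR; apply: le_lt_trans.
rewrite ler_norml lerBlDr; apply/andP; split.
  rewrite lerNl opprB lerBlDr -[X in Normc.normc X](subrK (f z)).
  apply: le_trans (normcD_le _ _) _.
  by rewrite normcB_sym.
by rewrite -[X in Normc.normc X](subrK (f w)) (le_trans (normcD_le _ _)).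
Qed.

Lemma compact_normc_bounded K (f : C2 R -> R[i]) : compact K ->
  (forall z, f w @[w --> z] --> (f z : Cplx R)) ->
  exists M, forall z, K z -> Normc.normc (f z) <= M.
Proof.
move=> cK /continuous_normc cf.
have /compact_bounded[M [_ HM]] := continuous_compact (continuous_subspaceT cf) cK.
exists (M + 1) => z Kz; apply: le_trans (ler_norm _) _.
by apply: (HM (M + 1)); [rewrite ltrDl | exists z].
Qed.

(** The coordinates are continuous, hence bounded on [K], and boundedness passes to products, scalar
    multiples and sums. *)
Lemma eval_bounded K (p : {mpoly R[i][2]}) : compact K ->
  exists M, forall z, K z -> Normc.normc (eval_at p z) <= M.
Proof.
move=> cK; rewrite /eval_at [p]mpolyE.
apply: (big_ind (fun q : {mpoly R[i][2]} =>
  exists M, forall z, K z -> Normc.normc (q.@[coords z]) <= M)).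
- by exists 0 => z _; rewrite meval0 Normc.normc0.
- move=> a b [M hM] [N hN]; exists (M + N) => z Kz; rewrite mevalD.
  by apply: le_trans (normcD_le _ _) _; rewrite lerD ?hM ?hN.
move=> m _; have [M hM] : exists M, forall z, K z -> Normc.normc ('X_[m].@[coords z]) <= M.
  rewrite mpolyXE_id; apply: (big_ind (fun q : {mpoly R[i][2]} =>
    exists M, forall z, K z -> Normc.normc (q.@[coords z]) <= M)).
  - by exists 1 => z _; rewrite meval1 Normc.normc1.
  - move=> a b [M hM] [N hN]; exists (M * N) => z Kz; rewrite mevalM Normc.normcM.
    by apply: ler_pM; rewrite ?normc_ge0 ?hM ?hN.
  move=> i _; have [M hM] : exists M, forall z, K z -> Normc.normc (coords z i) <= M.
    apply: compact_normc_bounded => // z; rewrite /coords; case: ifP => _.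
      exact: cvg_fst.
    exact: cvg_snd.
  exists (M ^+ m i) => z Kz; rewrite rmorphXn /= mevalXU.
  elim: (m i) => [|n IH]; first by rewrite !expr0 Normc.normc1.
  by rewrite !exprS Normc.normcM; apply: ler_pM; rewrite ?normc_ge0 ?hM.
exists (Normc.normc p@_m * M) => z Kz; rewrite mevalZ Normc.normcM.
by apply: ler_wpM2l; rewrite ?normc_ge0 ?hM.
Qed.

End CoordinateNorms.

(** * The sup norm as a submultiplicative seminorm on the coordinate ring *)

Section SupNorm.
Variables (R : realType) (P : {mpoly R[i][2]}) (irrP : irreducible_mpoly P).
Variable K : set (C2 R).
Hypotheses (K_sub : K `<=` curve P) (K_compact : compact K).
Implicit Types (f g : coord_ring irrP).

(** [value] evaluates a chosen representative; it differs from [p] by a multiple of [P], which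
    vanishes on [K]. *)
Lemma value_cls p z : K z -> value (cls irrP p) z = eval_at p z.
Proof.
move=> /K_sub Pz; have /cls_eqP[r e] : cls irrP (repr (cls irrP p)) = cls irrP p.
  exact: cls_repr.
apply/eqP; rewrite -subr_eq0 /value /eval_at -mevalB e mevalM.
by rewrite [P.@[_]]Pz mulr0.
Qed.

Lemma valueD f g z : K z -> value (f + g) z = value f z + value g z.
Proof.
by move=> Kz; rewrite -{1}(cls_repr f) -{1}(cls_repr g) -clsD value_cls // /eval_at mevalD.
Qed.

Lemma valueM f g z : K z -> value (f * g) z = value f z * value g z.
Proof.
by move=> Kz; rewrite -{1}(cls_repr f) -{1}(cls_repr g) -clsM value_cls // /eval_at mevalM.
Qed.

Lemma le_sup_norm f z : K z -> Normc.normc (value f z) <= sup_norm K f.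
Proof.
move=> Kz; apply: ub_le_sup; last by exists z.
by have [M hM] := eval_bounded (repr f) K_compact; exists M => _ [w Kw <-]; exact: hM.
Qed.

Lemma sup_norm_ge0 f : 0 <= sup_norm K f.
Proof.
(* The supremum over an empty [K] is 0 by convention. *)
have [->|/set0P[z Kz]] := eqVneq K set0; first by rewrite /sup_norm image_set0 sup0.
exact: le_trans (normc_ge0 _) (le_sup_norm f Kz).
Qed.

Lemma sup_norm_le f M : 0 <= M -> (forall z, K z -> Normc.normc (value f z) <= M) ->
  sup_norm K f <= M.
Proof.
move=> M0 h; have [->|/set0P[z Kz]] := eqVneq K set0.
  by rewrite /sup_norm image_set0 sup0.
by apply: ge_sup; [exists (Normc.normc (value f z)), z | move=> _ [w Kw <-]; exact: h].
Qed.

Lemma sup_normM f g : sup_norm K (f * g) <= sup_norm K f * sup_norm K g.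
Proof.
apply: sup_norm_le => [|z Kz]; first by rewrite mulr_ge0 ?sup_norm_ge0.
by rewrite valueM // Normc.normcM ler_pM ?normc_ge0 ?le_sup_norm.
Qed.

Lemma sup_normD f g : sup_norm K (f + g) <= sup_norm K f + sup_norm K g.
Proof.
apply: sup_norm_le => [|z Kz]; first by rewrite addr_ge0 ?sup_norm_ge0.
by rewrite valueD // (le_trans (normcD_le _ _)) // lerD ?le_sup_norm.
Qed.

Lemma sup_normZ (a : R[i]) f :
  sup_norm K (cls irrP a%:MP * f) <= Normc.normc a * sup_norm K f.
Proof.
apply: sup_norm_le => [|z Kz]; first by rewrite mulr_ge0 ?sup_norm_ge0 ?normc_ge0.
rewrite valueM // value_cls // /eval_at mevalC Normc.normcM.
by rewrite ler_wpM2l ?normc_ge0 ?le_sup_norm.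
Qed.

Lemma sup_norm_sum (I : Type) (r : seq I) (Q : pred I) (f : I -> coord_ring irrP) :
  sup_norm K (\sum_(i <- r | Q i) f i) <= \sum_(i <- r | Q i) sup_norm K (f i).
Proof.
apply: (big_ind2 (fun g x => sup_norm K g <= x)) => //.
  have := sup_normZ 0 0; rewrite mulr0 Normc.normc0 mul0r; exact.
by move=> g x h y gx hy; apply: le_trans (sup_normD _ _) _; exact: lerD.
Qed.

(** Unbounded degrees make [within (degrees N) \oo] a proper filter, to which the limit over all n
    restricts. As [x] has to match the infimum only at large degrees of the class, it may
    interpolate between them. *)
Lemma cheb_const_cvg (N : set (coord_ring irrP)) (x : nat -> R) (L : R) :
  unbounded_degrees N ->
  (\forall n \near \oo, degrees N n ->
     inf [set sup_norm K f | f in [set f | N f /\ degree f = n]] = x n) ->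
  x n `^ n%:R^-1 @[n --> \oo] --> L ->
  cheb_const_exists K N /\ cheb_const K N = L.
Proof.
move=> uN eN cx; have PF : ProperFilter (within (degrees N) \oo).
  apply: Build_ProperFilter => -[m _ hm]; have [n le_mn Nn] := uN m.
  exact: hm le_mn Nn.
have cN : cheb_const_n K N n @[n --> within (degrees N) \oo] --> L.
  have cw : x n `^ n%:R^-1 @[n --> within (degrees N) \oo] --> L.
    by apply: cvg_trans cx; apply: cvg_app; exact: cvg_within.
  apply: cvg_trans cw; apply: near_eq_cvg.
  by apply: filterS eN => n h Nn; rewrite /cheb_const_n h.
split; first by split=> //; exact: (cvgP _ cN).
exact: (cvg_lim (@Rhausdorff R) cN).
Qed.

End SupNorm.

(** Compare the coefficients of X^n in [q] and in its Lagrange interpolation formula at n + 1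
    nodes. *)
Lemma lagrange_lead_coef (F : fieldType) n (x : 'I_n.+1 -> F) (q : {poly F}) :
  injective x -> q \is monic -> size q = n.+1 ->
  \sum_j q.[x j] * (\prod_(i | i != j) (x j - x i))^-1 = 1.
Proof.
move=> x_inj mq sq; pose l j : {poly F} := \prod_(i | i != j) ('X - (x i)%:P).
have sl j : size (l j) = n.+1.
  rewrite /l -big_filter size_prod_XsubC size_filter -sum1_count.
  by rewrite sum1_card cardC1 card_ord.
have ml j : l j \is monic by exact: monic_prod_XsubC.
pose w j := \prod_(i | i != j) (x j - x i).
have lx j i : (l j).[x i] = if i == j then w j else 0.
  rewrite horner_prod; case: eqVneq => [->|ne].
    by apply: eq_bigr => k _; rewrite hornerXsubC.
  by rewrite (bigD1 i) //= hornerXsubC subrr mul0r.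
have w0 j : w j != 0.
  by apply/prodf_neq0 => i ne; rewrite subr_eq0; apply: contra ne => /eqP/x_inj ->.
have -> : \sum_j q.[x j] * (w j)^-1 = (\sum_j (q.[x j] * (w j)^-1) *: l j)`_n.
  rewrite coef_sum; apply: eq_bigr => j _; rewrite coefZ.
  by have := ml j; rewrite monicE lead_coefE sl => /eqP ->; rewrite mulr1.
suff <- : q = \sum_j (q.[x j] * (w j)^-1) *: l j.
  by move: mq; rewrite monicE lead_coefE sq => /eqP.
apply/eqP; rewrite -subr_eq0; apply/eqP.
apply: (@roots_geq_poly_eq0 _ _ [seq x i | i <- enum 'I_n.+1]).
- apply/allP => _ /mapP[i _ ->]; rewrite rootE hornerD hornerN horner_sum.
  rewrite (bigD1 i) //= big1 => [|j ne].
    by rewrite addr0 hornerZ lx eqxx divfK ?subrr.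
  by rewrite hornerZ lx eq_sym (negbTE ne) mulr0.
- by rewrite map_inj_uniq // enum_uniq.
- rewrite size_map size_enum_ord; apply: leq_trans (size_polyD _ _) _.
  rewrite size_polyN sq geq_max leqnn; apply: leq_trans (size_sum _ _ _) _.
  by apply/bigmax_leqP => j _; apply: leq_trans (size_scale_leq _ _) _; rewrite sl.
Qed.

Lemma le_exprn (R : realDomainType) (a b : R) n : 0 <= a -> a <= b -> a ^+ n <= b ^+ n.
Proof. by move=> a0 ab; apply: lerXn2r; rewrite ?nnegrE ?(le_trans a0). Qed.

(** * Chebyshev constants *)

Section ChebyshevConstants.
Variables (R : realType) (P : {mpoly R[i][2]}) (d : nat).
Variables (c : R[i]) (lambda : 'I_d -> R[i]) (K : set (C2 R)).
Variable irrP : irreducible_mpoly P.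
Hypotheses (d_ge2 : (2 <= d)%N) (degP : has_degree P d) (c_neq0 : c != 0).
Hypothesis lambda_inj : injective lambda.
Hypothesis leadP : hom_part P d = c *: \prod_(k < d) (z2 R - lambda k *: z1 R).
Hypotheses (K_sub : K `<=` curve P) (K_compact : compact K).
Implicit Types (f g : coord_ring irrP).
Local Notation norm := (sup_norm K).
Local Notation delta k := (fun j => (j == k)%:R : R[i]).

Let norm_ge0 f : 0 <= norm f. Proof. exact: sup_norm_ge0. Qed.

(** Let [x n] be the infimum of the norms of elements whose leading values in degree n are the
    indicator of lambda_k. A product of two such elements is again one, so Fekete's lemma applies;
    at positive multiples of d - 1, [x n] is the infimum defining the directional constant. The
    bounds thus extend to degrees that are not such multiples. *)
Lemma dir_cheb_const (k : 'I_d) : let L := cheb_const K (dir_class irrP lambda k) in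
  [/\ 0 <= L,
      forall n f, (d - 1 <= n)%N -> lead lambda n f (delta k) -> L ^+ n <= norm f &
      forall b, L < b -> exists2 C, 0 < C & exists n0, forall n, (n0 <= n)%N ->
        exists2 f : coord_ring irrP, lead lambda n f (delta k) & norm f <= C * b ^+ n].
Proof.
pose S n := [set norm f | f in [set f : coord_ring irrP | lead lambda n f (delta k)]].
pose x n := inf (S n).
have S0 n a : S n a -> 0 <= a by move=> [f _ <-].
have neS n : (d - 1 <= n)%N -> S n !=set0.
  by move=> /(lead_exists irrP lambda_inj k)[f Lf]; exists (norm f), f.
have x0 n : 0 <= x n by apply: inf_ge0; exact: S0.
have x_le n f : lead lambda n f (delta k) -> x n <= norm f.
  by move=> Lf; apply: ge_inf; [apply: has_lbound_ge0; exact: S0 | exists f].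
have xM n m : (d - 1 <= n)%N -> (d - 1 <= m)%N -> x (n + m)%N <= x n * x m.
  move=> le_n le_m; apply: le_inf_mulr => //; [exact: neS | exact: S0|].
  move=> _ [f Lf <-]; rewrite mulrC; apply: le_inf_mulr => //; [exact: neS | exact: S0|].
  move=> _ [g Lg <-]; rewrite mulrC; apply: le_trans (sup_normM K_sub K_compact _ _).
  apply: x_le; apply: eq_lead (leadM Lf Lg) => j.
  by case: eqP => _; rewrite ?mulr1 ?mulr0.
have d1 : (0 < d - 1)%N by rewrite subn_gt0.
have [L [L0 lowL upL]] := fekete d1 x0 xM.
have cx : x n `^ n%:R^-1 @[n --> \oo] --> L.
  apply: nth_root_cvg => // _; exists 1 => //; exists (d - 1)%N => n le_n.
  by rewrite mul1r lowL.
have [_ /= ->] : cheb_const_exists K (dir_class irrP lambda k) /\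
    cheb_const K (dir_class irrP lambda k) = L.
  apply: (cheb_const_cvg _ _ cx) => [m|].
    have le_m : (m <= m.+1 * (d - 1))%N by rewrite (leq_trans (leqnSn m)) // leq_pmulr.
    have le_d : (d - 1 <= m.+1 * (d - 1))%N by rewrite leq_pmull.
    exists (m.+1 * (d - 1))%N => //; have [f Lf] := lead_exists irrP lambda_inj k le_d.
    have m0 : (0 < m.+1 * (d - 1))%N by rewrite muln_gt0.
    have /(dir_classP degP c_neq0 lambda_inj leadP k f m0)[] :
      (d - 1 %| m.+1 * (d - 1))%N /\ lead lambda (m.+1 * (d - 1)) f (delta k).
      by rewrite dvdn_mull.
    by move=> Nf df; exists f.
  (* Degree 0 is left out, since [dir_classP] requires a positive degree. *)
  exists 1 => // n /= n_gt0 [h Nh dh]; congr (inf _); apply/seteqP.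
  have cP f := dir_classP degP c_neq0 lambda_inj leadP k f n_gt0.
  have dvd_n : (d - 1 %| n)%N by have [] := (cP h).1 (conj Nh dh).
  split=> _ [f Hf <-]; exists f => //=; first by have [] := (cP f).1 Hf.
  by apply/(cP f).
split=> // [n f le_n Lf|b lt_b]; first exact: le_trans (lowL _ le_n) (x_le _ _ Lf).
have b0 : 0 < b by exact: le_lt_trans lt_b.
(* The infimum may not be attained; C + 1 makes the bound strict, so that some element satisfies
   it. *)
have [C C0 [n1 h]] := upL b lt_b; exists (C + 1); first by rewrite addr_gt0.
exists (maxn n1 (d - 1)) => n; rewrite geq_max => /andP[le_n1 le_n].
have lt_x : x n < (C + 1) * b ^+ n.
  by apply: le_lt_trans (h n le_n1) _; rewrite ltr_pM2r ?exprn_gt0 // ltrDl.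
have [_ [f Lf <-] lt_f] := inf_lt (neS n le_n) lt_x.
by exists f => //; exact: ltW.
Qed.

(** * Monomial classes for ordered directions *)

Hypothesis sorted_dirs : forall i j : 'I_d, (i <= j)%N ->
  cheb_const K (dir_class irrP lambda j) <= cheb_const K (dir_class irrP lambda i).
Variable k : 'I_d.
Local Notation L := (cheb_const K (dir_class irrP lambda k)).
Local Notation monomial_lead n f := (exists q : {poly R[i]},
  [/\ q \is monic, size q = k.+1 & lead lambda n f (fun j => q.[lambda j])]).

(** [below] lists the k zeros imposed on the leading form in the upper bound, [upto] the k + 1
    interpolation nodes of the lower bound. *)
Definition below (i : 'I_k) : 'I_d := widen_ord (ltnW (ltn_ord k)) i.
Definition upto (i : 'I_k.+1) : 'I_d := widen_ord (ltn_ord k) i.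

(* The leading form vanishing in the first k directions is a combination of
   the remaining ones, whose Chebyshev constants are at most L. *)
Lemma monomial_upper b : L < b -> exists2 C, 0 < C & exists n0, forall n,
  (n0 <= n)%N -> exists2 f : coord_ring irrP, monomial_lead n f & norm f <= C * b ^+ n.
Proof.
move=> lt_b; have b0 : 0 < b by have [L0 _ _] := dir_cheb_const k; exact: le_lt_trans lt_b.
pose q : {poly R[i]} := \prod_(i < k) ('X - (lambda (below i))%:P).
have mq : q \is monic by exact: monic_prod_XsubC.
have sq : size q = k.+1.
  by rewrite size_prod_XsubC -[index_enum _]enumT size_enum_ord.
have q0 (j : 'I_d) : (j < k)%N -> q.[lambda j] = 0.
  move=> lt_j; rewrite horner_prod (bigD1 (Ordinal lt_j)) //= hornerXsubC.
  by rewrite (_ : below _ = j) ?subrr ?mul0r //; exact/val_inj.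
(* [D j] packs the constant and the threshold degree of direction j, with a dummy value for j <
   k. *)
have /choice[D hD] : forall j : 'I_d, exists D : R * nat, 0 < D.1 /\
    ((k <= j)%N -> forall n, (D.2 <= n)%N ->
      exists2 f : coord_ring irrP, lead lambda n f (delta j) & norm f <= D.1 * b ^+ n).
  move=> j; have [le_kj|] := leqP k j; last by exists (1, 0%N).
  have [_ _ /(_ b)[|C C0 [n0 h]]] := dir_cheb_const j.
    by apply: le_lt_trans lt_b; exact: sorted_dirs.
  by exists (C, n0).
exists (1 + \sum_(j < d | (k <= j)%N) Normc.normc q.[lambda j] * (D j).1).
  apply: ltr_pwDl => //; apply: sumr_ge0 => j _.
  by rewrite mulr_ge0 ?normc_ge0 //; have [/ltW] := hD j.
exists (\max_(j < d) (D j).2)%N => n le_n.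
have /choice[f hf] : forall j : 'I_d, exists f : coord_ring irrP, (k <= j)%N ->
    lead lambda n f (delta j) /\ norm f <= (D j).1 * b ^+ n.
  move=> j; have [le_kj|] := leqP k j; last by exists 0.
  have [_ /(_ le_kj n)[|f Lf nf]] := hD j; last by exists f.
  by apply: leq_trans le_n; rewrite (bigD1 j) //= leq_maxl.
(* The weights q(lambda_j) reproduce the leading values of [q], because the omitted directions are
   zeros of [q]. *)
exists (\sum_(j < d | (k <= j)%N) cls irrP (q.[lambda j])%:MP * f j).
  exists q; split=> //.
  have := @lead_sum _ _ irrP _ lambda n _ (index_enum 'I_d)
    (fun j : 'I_d => (k <= j)%N) (fun j => cls irrP (q.[lambda j])%:MP * f j)
    (fun j i => q.[lambda j] * (i == j)%:R).
  move=> /(_ (fun j kj => leadZ _ (hf j kj).1)); apply: eq_lead => i.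
  have [le_ki|lt_ik] := leqP k i.
    rewrite (bigD1 i) //= eqxx mulr1 big1 ?addr0 // => j /andP[_ ne].
    by rewrite eq_sym (negbTE ne) mulr0.
  rewrite q0 // big1 // => j le_kj; case: eqP => [e|_]; last by rewrite mulr0.
  by move: lt_ik; rewrite e ltnNge le_kj.
apply: le_trans (sup_norm_sum K_sub K_compact _ _ _) _.
rewrite mulrDl mul1r -[leLHS]add0r lerD ?exprn_ge0 ?(ltW b0) // mulr_suml.
apply: ler_sum => j le_kj; apply: le_trans (sup_normZ K_sub K_compact _ _) _.
by rewrite -mulrA ler_wpM2l ?normc_ge0 //; have [] := hf j le_kj.
Qed.

(* Multiplying by the dir_poly of a direction isolates the value of the leading
   form there, and Lagrange interpolation shows that the values in the first
   k + 1 directions cannot all be small. *)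
Lemma monomial_lower : 0 < L -> exists2 C, 0 < C & exists n0, forall n,
  (n0 <= n)%N -> forall f, monomial_lead n f -> C * L ^+ n <= norm f.
Proof.
move=> L0; pose v j := cls irrP (dir_poly lambda j).
(* Moduli of the Lagrange weights at the first k + 1 directions. *)
pose A (j : 'I_k.+1) := Normc.normc (\prod_(i | i != j) (lambda (upto j) - lambda (upto i)))^-1.
pose B := 1 + \sum_j A j * norm (v (upto j)).
have B0 : 0 < B.
  by apply: ltr_pwDl => //; apply: sumr_ge0 => j _; rewrite mulr_ge0 ?normc_ge0.
(* The power of L accounts for the degree d - 1 added on multiplying by v_j. *)
exists (L ^+ (d - 1) / B); first by rewrite divr_gt0 // exprn_gt0.
exists 0%N => n _ f [q [mq sq Lf]].
rewrite mulrAC -exprD addnC ler_pdivrMr //.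
have upto_inj : injective (fun j => lambda (upto j)).
  by move=> i j /lambda_inj/(congr1 val)/= e; exact/val_inj.
have val_le j : Normc.normc q.[lambda (upto j)] * L ^+ (n + (d - 1))
    <= norm f * norm (v (upto j)).
  have [->|a0] := eqVneq q.[lambda (upto j)] 0.
    by rewrite Normc.normc0 mul0r mulr_ge0.
  have na0 : 0 < Normc.normc q.[lambda (upto j)].
    by rewrite lt_def normc_ge0 andbT; apply: contra a0 => /eqP/Normc.eq0_normc ->.
  (* Divided by q(lambda_j), the product of [f] and v_j has indicator leading values, so its norm is
     bounded below by the directional constant; its degree bound is at least d - 1 for every n. *)
  have Lfv : lead lambda (n + (d - 1))
      (cls irrP (q.[lambda (upto j)]^-1)%:MP * (f * v (upto j))) (delta (upto j)).
    apply: eq_lead (leadZ _ (leadM Lf (lead_dir irrP lambda_inj (upto j)))) => i.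
    by case: eqVneq => [->|_]; rewrite ?mulr0 // mulr1 mulVf.
  have [_ /(_ _ _ (leq_addl _ _) Lfv) low _] := dir_cheb_const (upto j).
  (* The ordering of the directions enters here: the index is at most k, so the constant is at least
     L. *)
  have LL : L ^+ (n + (d - 1)) <= cheb_const K (dir_class irrP lambda (upto j)) ^+ (n + (d - 1)).
    exact: le_exprn (ltW L0) (@sorted_dirs (upto j) k (ltn_ord j)).
  rewrite mulrC -ler_pdivlMr // mulrC; apply: le_trans (le_trans LL low) _.
  apply: le_trans (sup_normZ K_sub K_compact _ _) _.
  rewrite Normc.normcV; apply: ler_wpM2l; first by rewrite invr_ge0 normc_ge0.
  exact: (sup_normM K_sub K_compact).
have := lagrange_lead_coef upto_inj mq sq.
move=> /(congr1 (@Normc.normc R)); rewrite Normc.normc1 => e1.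
have le1 : 1 <= \sum_j Normc.normc q.[lambda (upto j)] * A j.
  rewrite -e1; apply: (big_ind2 (fun x y => Normc.normc x <= y)).
  - by rewrite Normc.normc0.
  - by move=> a b a' b' ha hb; apply: le_trans (normcD_le _ _) (lerD ha hb).
  - by move=> j _; rewrite Normc.normcM.
have Ln0 : 0 <= L ^+ (n + (d - 1)) by rewrite exprn_ge0 // ltW.
apply: le_trans (_ : (\sum_j Normc.normc q.[lambda (upto j)] * A j) * L ^+ (n + (d - 1)) <= _).
  by rewrite -[leLHS]mul1r ler_wpM2r.
rewrite mulr_suml /B mulrDr mulr1 -[leLHS]add0r lerD // mulr_sumr; apply: ler_sum => j _.
rewrite mulrAC [leLHS]mulrC [leRHS]mulrCA; apply: ler_wpM2l (val_le j).
exact: normc_ge0.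
Qed.

(** For large n the infimum in degree n is at most C b^n for each b > L, with C depending on b, and
    at least a constant times L^n when L > 0; taking n-th roots gives the limit L. *)
Lemma monomial_cheb_const :
  cheb_const_exists K (monomial_class irrP d k) /\
  cheb_const K (monomial_class irrP d k) = L.
Proof.
pose S n := [set norm f | f in [set f : coord_ring irrP | monomial_lead n f]].
have cP := monomial_classP (irrP := irrP) degP c_neq0 lambda_inj leadP d_ge2 k.
have S0 n a : S n a -> 0 <= a by move=> [f _ <-].
have [L0 _ _] := dir_cheb_const k.
have neS n : (k <= n)%N -> S n !=set0.
  move=> le_kn; pose e := expo (n - k) k; exists (norm (cls irrP 'X_[e])), (cls irrP 'X_[e]) => //=.
  exists 'X^k; split; rewrite ?monicXn ?size_polyXn //.
  have := lead_X irrP lambda e; rewrite mdeg_expo subnK //; apply: eq_lead => j.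
  by rewrite hornerXn expo_max.
apply: (cheb_const_cvg (x := fun n => inf (S n))) => [m||].
- have [_ [f mf _]] := neS _ (leq_addr m k); exists (k + m)%N; first exact: leq_addl.
  by have [Nf df] := (cP _ _).2 mf; exists f.
- exists 0%N => // n _ _; congr (inf _); apply/seteqP.
  by split=> _ [f Hf <-]; exists f => //; exact/cP.
apply: nth_root_cvg => // [n|b lt_b|L_gt0]; first by apply: inf_ge0; exact: S0.
  have [C C0 [n0 h]] := monomial_upper lt_b; exists C => //; exists n0 => n /h[f mf nf].
  apply: le_trans nf; apply: ge_inf; last by exists f.
  by apply: has_lbound_ge0; exact: S0.
(* Degree at least k makes the set of norms nonempty, which matters because the infimum of the empty
   set is 0 by convention. *)
have [C C0 [n0 h]] := monomial_lower L_gt0; exists C => //; exists (maxn n0 k) => n.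
rewrite geq_max => /andP[le_n le_k]; apply: lb_le_inf; first exact: neS.
by move=> _ [f mf <-]; exact: h.
Qed.

End ChebyshevConstants.

Theorem theorem1p5 (R : realType) (P : {mpoly R[i][2]}) (d : nat)
    (c : R[i]) (lambda : 'I_d -> R[i]) (K : set (C2 R))
    (irrP : irreducible_mpoly P)
    (d_ge2 : (2 <= d)%N)
    (degP : has_degree P d)
    (c_neq0 : c != 0)
    (lambda_inj : injective lambda)
    (lambda_neq0 : forall k : 'I_d, lambda k != 0)
    (leadP : hom_part P d = c *: \prod_(k < d) (z2 R - lambda k *: z1 R))
    (K_sub : K `<=` curve P)
    (K_compact : compact K)
    (K_nonpolar : nonpolar P K)
    (sorted_dirs : forall i j : 'I_d, (i <= j)%N ->
       cheb_const K (dir_class irrP lambda j)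
         <= cheb_const K (dir_class irrP lambda i))
    (k : 'I_d) :
  cheb_const_exists K (monomial_class irrP d k) /\
  cheb_const K (monomial_class irrP d k)
    = cheb_const K (dir_class irrP lambda k).
Proof.
exact: (monomial_cheb_const d_ge2 degP c_neq0 lambda_inj leadP K_sub K_compact
  sorted_dirs k).
Qed.
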